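(* For any integer $\ell\geq 2$ and any $\alpha\in(0,1)$ such that $\alpha\ell>1$, if a graph $G=(V,E)$ has minimum degree $\delta\geq\frac{2\ell-2}{\alpha\ell-1}$, then $G$ has an $\alpha$-majority edge colouring from lists of size $\ell$; that is, for every set of colours $C$ and every list assignment $L:E\to 2^C$ with $|L(e)|=\ell$ for all $e\in E$, there is a colouring $\omega:E\to C$ such that $\omega(e)\in L(e)$ for every $e\in E$ and, for every vertex $v\in V$ and every colour $c\in C$, the number of edges incident with $v$ that are coloured $c$ is at most $\alpha d(v)$.
   Context: A graph means a finite simple graph. $d(v)$ denotes the degree of the vertex $v$ in $G$. Edge colourings are not required to be proper. *)

(* Defs.v *)
From mathcomp Require Import all_boot all_order all_algebra.
From mathcomp Require Import finmap reals.

Set Implicit Arguments.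
Unset Strict Implicit.
Unset Printing Implicit Defensive.

Import Order.TTheory GRing.Theory Num.Theory.

Record sgraph := SGraph {
  vertex :> finType;
  adj : rel vertex;
  adj_sym : symmetric adj;
  adj_irr : irreflexive adj
}.

Section Graph.
Variable G : sgraph.
Implicit Types (v : G).

Definition edge_set : {set {set G}} :=
  [set [set p.1; p.2] | p in [pred p : G * G | adj p.1 p.2]].

Definition edge := {e : {set G} | e \in edge_set}.

Definition degree v : nat := #|[set u | adj v u]|.

(* Every degree is smaller than #|G|, so for a nonempty graph the default value
   #|G| plays no role; the graph without vertices gets minimum degree 0. *)
Definition min_degree : nat := \big[minn/#|G|]_(v : G) degree v.

Lemma degree_lt_card v : degree v < #|G|.
Proof.
rewrite -cardsT; apply: proper_card; apply/properP; split; first exact: subsetT.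
by exists v; rewrite ?inE ?adj_irr.
Qed.

Lemma min_degree_le v : min_degree <= degree v.
Proof.
rewrite /min_degree; elim: index_enum (mem_index_enum v) => // u s IHs.
rewrite inE big_cons geq_min => /predU1P[<- | /IHs ->]; first by rewrite leqnn.
exact: orbT.
Qed.

Lemma min_degree_attained (v0 : G) : exists v, min_degree = degree v.
Proof.
have [v _ vmin] := arg_minnP (P := xpredT) degree (erefl : xpredT v0).
exists v; apply/eqP; rewrite eqn_leq min_degree_le /= /min_degree.
elim/big_ind: _ => [|m n le_m le_n|u _]; first exact/ltnW/degree_lt_card.
  by rewrite leq_min le_m.
exact: vmin.
Qed.

Definition majority_edge_colouring (R : realType) (C : choiceType) (alpha : R)
    (w : edge -> C) : Prop :=
  forall (v : G) (c : C),
    (#|[set e : edge | (v \in val e) && (w e == c)]|%:R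
       <= alpha * (degree v)%:R)%R.

End Graph.

(* Main.v *)
Require Import Defs.
From mathcomp Require Import all_boot all_order all_algebra.
From mathcomp Require Import finmap reals.
From mathcomp Require Import perm zify lra.

Set Implicit Arguments.
Unset Strict Implicit.
Unset Printing Implicit Defensive.

Import Order.TTheory GRing.Theory Num.Theory.
Local Open Scope ring_scope.

(** Write [l = n.+1].  The hypothesis on the minimum degree says that
    [alpha * d v >= (d v + 2 * n) / l] for every vertex [v], so it suffices to
    colour from the lists in such a way that each colour occurs at most
    [(d v + 2 * n) / l] times at [v] (balanced_list_colouring).

    Orient every edge arbitrarily.  At each vertex, cut the outgoing edges into
    blocks of at most [l] edges, all full but possibly one, and do the same with
    the ingoing edges (split_fibres).  Taking the out-blocks and the in-blocks as
    new vertices turns [G] into a bipartite graph of maximum degree at most [l].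
    By Galvin's theorem it has a proper edge colouring from any lists of size
    [l].  A colour then occurs at most once in each block, and if [v] has [d1]
    outgoing and [d2] ingoing edges, the number of its blocks is at most
    [(d1 + n) / l + (d2 + n) / l = (d v + 2 * n) / l].

    Galvin's theorem (galvin) is proved in the classical way.  A bipartite graph
    is given by the finite type [E] of its edges and the two maps [a : E -> A]
    and [b : E -> B] sending an edge to its ends on either side, and a map [f] is
    a proper colouring when both [(a, f)] and [(b, f)] are injective.  Koenig's
    theorem (koenig) gives a proper colouring with [l] colours, by alternating
    paths; it orients the line graph with all out-degrees less than [l]
    (galvin_outdegree); every induced subgraph of this orientation has a kernel,
    which is a stable matching (galvin_kernel); and a digraph with that property
    can be coloured from lists longer than the out-degrees
    (kernel_list_colouring). *)

(** * Koenig's edge colouring theorem *)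

Lemma ex_missing_colour (E : finType) (A : eqType) (n : nat) (a : E -> A)
    (f : E -> 'I_n.+1) (B : {set E}) (e : E) :
    e \notin B -> (#|[set x | a x == a e]| <= n.+1)%N ->
  exists c, {in B, forall x, a x = a e -> f x != c}.
Proof.
move=> eB len.
set M := [set x in B | a x == a e].
have ltM : (#|f @: M| < n.+1)%N.
  apply: leq_ltn_trans (leq_imset_card _ _) _.
  apply: leq_trans len; apply: proper_card; apply/properP; split.
    by apply/subsetP=> x; rewrite !inE => /andP[].
  by exists e; rewrite !inE ?eqxx // (negPf eB).
have [c _ cM] : exists2 c, c \in [set: 'I_n.+1] & c \notin f @: M.
  apply/subsetPn; apply: contraTN ltM => /subset_leq_card.
  by rewrite cardsT card_ord -leqNgt.
exists c => x xB axe; apply: contra cM => /eqP <-.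
by apply: imset_f; rewrite inE xB axe eqxx.
Qed.

(** The alternating path argument.  [p] is free at the [a]-end of the new edge
    [e] and [q] at its [b]-end.  Exchanging [p] and [q] along the path of edges
    coloured [q, p, q, ...] that starts at the [a]-end frees [q] there, and [e]
    can be coloured [q] provided that the path avoids the [b]-end.  It does:
    following the path, one comes to a [b]-side vertex along an edge coloured
    [q], and [q] is free at the [b]-end of [e]. *)
Lemma koenig_extension (E : finType) (A B : eqType) (C : finType)
    (a : E -> A) (b : E -> B) (f : E -> C) (S : {set E}) (e : E) (p q : C) :
    {in S &, injective (fun x => (a x, f x))} ->
    {in S &, injective (fun x => (b x, f x))} ->
    {in S, forall x, a x = a e -> f x != p} ->
    {in S, forall x, b x = b e -> f x != q} ->
  exists g : E -> C,
    {in e |: S &, injective (fun x => (a x, g x))} /\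
    {in e |: S &, injective (fun x => (b x, g x))}.
Proof.
move=> fa fb ep eq.
(* [r] steps along the path, whose first edge is the one satisfying [root]; [K]
   is the set of its edges. *)
pose r x y := [&& x \in S, y \in S & [&& f x == q, f y == p & b x == b y]
                               || [&& f x == p, f y == q & a x == a y]].
pose root y := [&& y \in S, a y == a e & f y == q].
pose K := [set x | [exists y, root y && connect r y x]].
have rootK y : root y -> y \in K.
  by move=> ry; rewrite inE; apply/existsP; exists y; rewrite ry connect0.
have stepK x y : x \in K -> r x y -> y \in K.
  rewrite !inE => /existsP[z /andP[rz zx]] xy; apply/existsP; exists z.
  by rewrite rz (connect_trans zx) // connect1.
have predK x : x \in K -> root x \/ exists2 z, z \in K & r z x.
  rewrite inE => /existsP[y /andP[ry /connectP[s]]].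
  case/lastP: s => [_ -> | s z]; first by left.
  rewrite rcons_path last_rcons => /andP[ys sz] ->; right.
  exists (last y s) => //; rewrite inE; apply/existsP; exists y; rewrite ry.
  by apply/connectP; exists s.
have KS x : x \in K -> x \in S.
  by case/predK => [/and3P[] | [z _ /and3P[]]].
have Kpq x : x \in K -> (f x == p) || (f x == q).
  case/predK => [/and3P[_ _ ->] | [z _ /and3P[_ _]]]; first by rewrite orbT.
  by case/orP=> /and3P[_ -> _] //; rewrite orbT.
(* [Ka] and [Kb]: at a vertex of the path, any edge coloured [p] or [q] is on the
   path, because it is the next edge, the previous one, or, at the [a]-end of
   [e], ruled out as [p] is free there. *)
have Ka x y : x \in K -> y \in S -> a x = a y -> (f y == p) || (f y == q) ->
    y \in K.
  move=> xK yS axy fy.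
  have [fxy|fxy] := eqVneq (f x) (f y).
    by rewrite -(fa x y) // ?KS // axy fxy.
  case/orP: fy (Kpq x xK) => /eqP fy; rewrite -fy (negPf fxy) ?orbF /=.
    move=> /eqP fx; case: (predK x xK) => [/and3P[_ /eqP axe _]|[z zK]].
      by move: (ep y yS); rewrite -axy fy eqxx => /(_ axe).
    rewrite /r -fy => /and3P[zS xS]; rewrite (negPf fxy) andbF /=.
    case/and3P=> /eqP fz _ /eqP azx.
    by rewrite -(fa z y) // azx axy fz.
  move=> /eqP fx; apply: (stepK x) => //.
  by rewrite /r KS // yS fx fy axy !eqxx orbT.
have Kb x y : x \in K -> y \in S -> b x = b y -> (f y == p) || (f y == q) ->
    y \in K.
  move=> xK yS bxy fy.
  have [fxy|fxy] := eqVneq (f x) (f y).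
    by rewrite -(fb x y) // ?KS // bxy fxy.
  case/orP: fy (Kpq x xK) => /eqP fy; rewrite -fy (negPf fxy) ?orbF /=.
    move=> /eqP fx; apply: (stepK x) => //.
    by rewrite /r KS // yS fx fy bxy !eqxx.
  move=> /eqP fx; case: (predK x xK) => [/and3P[_ _]|[z zK]].
    by rewrite -fy (negPf fxy).
  rewrite /r -fy => /and3P[zS xS]; rewrite (negPf fxy) andbF orbF.
  case/and3P=> /eqP fz _ /eqP bzx.
  by rewrite -(fb z y) // bzx bxy fz.
have Ke x : x \in K -> b x <> b e.
  move=> xK bx; have := eq x (KS x xK) bx.
  case: (predK x xK) => [/and3P[_ _ ->] // | [z zK /and3P[zS xS]]].
  case/orP=> /and3P[fz fx zx]; last by rewrite fx.
  by move: (eq z zS); rewrite fz (eqP zx) => /(_ bx).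
pose h x := if x \in K then tperm p q (f x) else f x.
(* Stated for both sides at once: [h] stays proper on a side as soon as the
   path is closed there. *)
have h_inj (D : eqType) (d : E -> D) :
    {in S &, injective (fun x => (d x, f x))} ->
    (forall x y, x \in K -> y \in S -> d x = d y -> (f y == p) || (f y == q) ->
       y \in K) ->
    {in S &, injective (fun x => (d x, h x))}.
  move=> fd Kd.
  have mix x y : x \in K -> y \in S -> y \notin K -> d x = d y ->
      tperm p q (f x) <> f y.
    move=> xK yS yK dxy txy; case/negP: yK; apply: (Kd x) => //.
    rewrite -txy; case/orP: (Kpq x xK) => /eqP ->.
      by rewrite tpermL eqxx orbT.
    by rewrite tpermR eqxx.
  move=> x y xS yS [dxy]; rewrite /h.
  case: ifPn => xK; case: ifPn => yK hxy.
  - by apply: fd => //; rewrite dxy (perm_inj hxy).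
  - by case: (mix x y).
  - by case: (mix y x).
  - by apply: fd => //; rewrite dxy hxy.
have hq (D : eqType) (d : E -> D) :
    {in S, forall x, d x = d e -> h x != q} ->
    {in S &, injective (fun x => (d x, h x))} ->
    {in e |: S &, injective (fun x => (d x, if x == e then q else h x))}.
  move=> dq hd x y; rewrite !inE.
  have [-> _|xe /= xS] := eqVneq x e; have [-> _|ye /= yS] := eqVneq y e => //.
  - by case=> dxy hy; move: (dq y yS (esym dxy)); rewrite hy eqxx.
  - by case=> dxy hx; move: (dq x xS dxy); rewrite hx eqxx.
  - by apply: hd.
exists (fun x => if x == e then q else h x); split; apply: hq.
- move=> x xS axe; rewrite /h; case: ifPn => xK.
    case/orP: (Kpq x xK) => /eqP fx.
      by move: (ep x xS axe); rewrite fx eqxx.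
    rewrite fx tpermR; apply: contra (ep x xS axe) => /eqP pq.
    by rewrite fx pq.
  apply: contra xK => fx; apply: rootK.
  by rewrite /root xS axe eqxx.
- exact: (h_inj _ a).
- move=> x xS bxe; rewrite /h; case: ifPn => xK; last exact: eq.
  by case: (Ke x).
- exact: (h_inj _ b).
Qed.

Lemma koenig (E : finType) (A B : eqType) (n : nat) (a : E -> A) (b : E -> B) :
    (forall e, (#|[set x | a x == a e]| <= n.+1)%N) ->
    (forall e, (#|[set x | b x == b e]| <= n.+1)%N) ->
  exists f : E -> 'I_n.+1,
    injective (fun x => (a x, f x)) /\ injective (fun x => (b x, f x)).
Proof.
move=> la lb.
have: forall S : {set E}, exists f : E -> 'I_n.+1,
    {in S &, injective (fun x => (a x, f x))} /\
    {in S &, injective (fun x => (b x, f x))}.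
  move=> S; have [m] := ubnP #|S|; elim: m S => // m IH S ltm.
  have [->|[e eS]] := set_0Vmem S.
    by exists (fun=> ord0); split=> x y; rewrite inE.
  move: ltm; rewrite (cardsD1 e) eS ltnS => /IH[f [fa fb]].
  have eS' : e \notin S :\ e by rewrite !inE eqxx.
  rewrite -(setD1K eS).
  have [p ep] := ex_missing_colour f eS' (la e).
  have [q eq] := ex_missing_colour f eS' (lb e).
  exact: koenig_extension fa fb ep eq.
case/(_ setT)=> f [fa fb]; exists f; split=> x y.
  by apply: fa; rewrite inE.
by apply: fb; rewrite inE.
Qed.

(** * List colouring from kernels *)

Definition is_kernel (E : finType) (o : rel E) (S K : {set E}) :=
  [/\ K \subset S, {in K &, forall x y, ~~ o x y} &
      {in S :\: K, forall x, exists2 y, y \in K & o x y}].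

(** The lemma of Bondy, Boppana and Siegel.  Choose a colour [c] that is in some
    list and give it to a kernel [K] of the set of vertices having [c] in
    their list.  Each other vertex of that set loses [c] from its list, but it
    also loses an out-neighbour, in [K], so induction applies outside [K].  The
    colour [c0] is a default value outside [S]. *)
Lemma kernel_list_colouring (E : finType) (o : rel E) (C : choiceType) (c0 : C)
    (S : {set E}) (L : E -> {fset C}) :
    (forall T : {set E}, exists K, is_kernel o T K) ->
    {in S, forall x, (#|[set y in S | o x y]| < #|` L x|)%N} ->
  exists w : E -> C,
    {in S, forall x, w x \in L x} /\ {in S &, forall x y, o x y -> w x != w y}.
Proof.
move=> kerP; have [m] := ubnP #|S|; elim: m S L => // m IH S L ltm degL.
have [->|[e0 e0S]] := set_0Vmem S.
  by exists (fun=> c0); split=> x; rewrite inE.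
have [c cL] : exists c, c \in L e0.
  by apply/fset0Pn; rewrite -cardfs_gt0; apply: leq_ltn_trans (degL _ e0S).
have [K [/subsetP KT indK absK]] := kerP [set x in S | c \in L x].
have KS x : x \in K -> x \in S by move/KT; rewrite inE => /andP[].
have [k kK] : exists k, k \in K.
  have [e0K|e0K] := boolP (e0 \in K); first by exists e0.
  by case: (absK e0) => [|y yK _]; [rewrite !inE e0K e0S cL | exists y].
have [||w [wL wo]] := IH (S :\: K) (fun x => (L x `\ c)%fset).
- rewrite ltnS in ltm; apply: leq_trans ltm; apply: proper_card.
  apply/properP; split; first exact: subsetDl.
  by exists k; rewrite ?KS // inE kK.
- move=> x; rewrite inE => /andP[xK xS].
  have [cx|cx] := boolP (c \in L x); last first.
    have -> : (L x `\ c = L x)%fset by apply/mem_fsetD1.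
    apply: leq_ltn_trans (degL x xS); apply: subset_leq_card.
    by apply/subsetP=> y; rewrite !inE => /andP[/andP[_ ->] ->].
  have := degL x xS; rewrite (cardfsD1 c (L x)) cx add1n ltnS.
  apply: leq_trans; apply: proper_card.
  have [|y yK oxy] := absK x; first by rewrite !inE xK xS cx.
  apply/properP; split; last by exists y; rewrite !inE ?KS ?oxy // yK.
  by apply/subsetP=> z; rewrite !inE => /andP[/andP[_ ->] ->].
exists (fun x => if x \in K then c else w x).
have wc x : x \in S -> x \notin K -> w x != c /\ w x \in L x.
  by move=> xS xK; have := wL x; rewrite !inE xS xK => /(_ isT)/andP[].
split=> [x xS | x y xS yS oxy].
  case: ifPn => [/KT|xK]; first by rewrite inE => /andP[].
  by case: (wc x xS xK).
case: ifPn => xK; case: ifPn => yK.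
- by rewrite (negPf (indK x y xK yK)) in oxy.
- by rewrite eq_sym; case: (wc y yS yK).
- by case: (wc x xS xK).
- by apply: wo; rewrite // inE ?xK ?yK.
Qed.

(** * Galvin's theorem *)

(** The orientation of the line graph: an edge prefers larger colours at its
    [a]-end and smaller colours at its [b]-end, and arcs point to preferred
    edges.  The opposite choices on the two sides keep the out-degrees below the
    number of colours. *)
Definition galvin_rel (E A B : eqType) (n : nat) (a : E -> A) (b : E -> B)
    (f : E -> 'I_n) : rel E :=
  fun x y => (a x == a y) && (f x < f y)%N || (b x == b y) && (f y < f x)%N.

(** A kernel is a stable matching in the sense of Gale and Shapley.  If the best
    edges at the [a]-side vertices have distinct [b]-ends, they form a kernel.
    Otherwise two of them compete for one [b]-end, and a kernel [K] remains one
    when the rejected edge [y] is put back: as the preferred competitor [x] has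
    no better edge at its [a]-end, either [x] is in [K], or [K] has an edge better
    than [x], hence better than [y], at their common [b]-end. *)
Lemma galvin_kernel (E : finType) (A B : eqType) (n : nat)
    (a : E -> A) (b : E -> B) (f : E -> 'I_n) :
    injective (fun x => (b x, f x)) ->
  forall S : {set E}, exists K, is_kernel (galvin_rel a b f) S K.
Proof.
move=> fb S; have [m] := ubnP #|S|; elim: m S => // m IH S ltm.
pose top x := [forall (y | y \in S), (a x == a y) ==> (f y <= f x)%N].
have topP x y : top x -> y \in S -> a x = a y -> (f y <= f x)%N.
  by move=> /forallP/(_ y)/implyP tx yS axy; apply: (implyP (tx yS)); apply/eqP.
pose bad := [pred z : E * E | [&& z.1 \in S, z.2 \in S, top z.1, top z.2,
                   b z.1 == b z.2 & (f z.1 < f z.2)%N]].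
have [[x y] /and5P[/= xS yS tx ty /andP[/eqP bxy fxy]] | nobad] := pickP bad.
  have xy : x != y by apply: contraTneq fxy => ->; rewrite ltnn.
  have [|K [KS indK absK]] := IH (S :\ y).
    by move: ltm; rewrite (cardsD1 y S) yS ltnS.
  exists K; split=> //; first exact: subset_trans KS (subsetDl _ _).
  move=> z; rewrite !inE => /andP[zK zS].
  have [->|zy] := eqVneq z y; last by apply: absK; rewrite !inE zK zy zS.
  have [xK|xK] := boolP (x \in K).
    by exists x; rewrite // /galvin_rel bxy eqxx fxy orbT.
  have [|t tK] := absK x; first by rewrite !inE xK xy xS.
  have tS : t \in S by have := subsetP KS t tK; rewrite !inE => /andP[].
  case/orP=> /andP[/eqP xt ft].
    by have := topP x t tx tS xt; rewrite leqNgt ft.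
  exists t; rewrite // /galvin_rel -bxy xt eqxx (ltn_trans ft fxy) orbT //.
exists [set x in S | top x]; split.
- by apply/subsetP=> x; rewrite inE => /andP[].
- move=> x y; rewrite !inE => /andP[xS tx] /andP[yS ty].
  apply/negP=> /orP[] /andP[/eqP xy fxy].
    by have := topP x y tx yS xy; rewrite leqNgt fxy.
  by have := nobad (y, x); rewrite /= xS yS tx ty xy eqxx fxy.
- move=> x; rewrite !inE => /andP[] /[swap] xS; rewrite xS /= => ntx.
  case: (@arg_maxnP _ x (fun y => (y \in S) && (a y == a x))
                        (fun y => f y : nat)).
    by rewrite xS eqxx.
  move=> y /andP[yS /eqP ayx] ymax.
  have ty : top y.
    apply/forallP=> z; apply/implyP=> zS; apply/implyP=> /eqP ayz.
    by apply: ymax; rewrite zS -ayz ayx eqxx.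
  exists y; rewrite ?inE ?yS //; apply/orP; left; rewrite ayx eqxx /=.
  rewrite ltnNge; apply: contra ntx => fyx.
  apply/forallP=> z; apply/implyP=> zS; apply/implyP=> /eqP axz.
  by apply: leq_trans fyx; apply: ymax; rewrite zS -axz eqxx.
Qed.

(** The out-neighbours of [x] have colours above [f x] when they meet [x] on the
    [a]-side and below [f x] on the [b]-side, so they have distinct colours, all
    different from [f x]. *)
Lemma galvin_outdegree (E : finType) (A B : eqType) (n : nat)
    (a : E -> A) (b : E -> B) (f : E -> 'I_n) (x : E) :
    injective (fun x => (a x, f x)) -> injective (fun x => (b x, f x)) ->
  (#|[set y | galvin_rel a b f x y]| < n)%N.
Proof.
move=> fa fb; rewrite -{2}(card_ord n) -cardsT (cardsD1 (f x)) inE add1n ltnS.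
rewrite -(@card_in_imset _ _ f) => [|y z].
  apply: subset_leq_card; apply/subsetP=> _ /imsetP[y + ->].
  rewrite !inE andbT -val_eqE neq_ltn => /orP[] /andP[_ ->] //.
  by rewrite orbT.
rewrite !inE => /orP[] /andP[/eqP xy fy] /orP[] /andP[/eqP xz fz] fyz.
- by apply: fa; rewrite -xy -xz fyz.
- by rewrite fyz ltnNge ltnW in fy.
- by rewrite fyz ltnNge ltnW in fy.
- by apply: fb; rewrite -xy -xz fyz.
Qed.

Lemma galvin (E : finType) (A B : eqType) (C : choiceType) (n : nat)
    (a : E -> A) (b : E -> B) (L : E -> {fset C}) :
    (forall e, (#|[set x | a x == a e]| <= n.+1)%N) ->
    (forall e, (#|[set x | b x == b e]| <= n.+1)%N) ->
    (forall e, (n < #|` L e|)%N) ->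
  exists w : E -> C, [/\ forall e, w e \in L e,
    injective (fun x => (a x, w x)) & injective (fun x => (b x, w x))].
Proof.
move=> la lb lL.
have [e0 _|noE] := pickP (@predT E); last first.
  have E0 (e : E) : False by have := noE e.
  by exists (fun e => match E0 e with end); split=> e; case: (E0 e).
have [c0 _] : exists c, c \in L e0.
  by apply/fset0Pn; rewrite -cardfs_gt0; apply: leq_ltn_trans (lL e0).
have [f [fa fb]] := koenig la lb.
have [x _|w [wL wo]] :=
  @kernel_list_colouring E _ C c0 setT L (galvin_kernel a fb).
  apply: leq_trans (lL x); rewrite ltnS.
  have := galvin_outdegree x fa fb; rewrite ltnS; apply: leq_trans.
  by apply: subset_leq_card; apply/subsetP=> y; rewrite !inE.
have wo' x y : galvin_rel a b f x y -> w x <> w y.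
  by move=> oxy; apply/eqP; apply: wo; rewrite ?inE.
exists w; split=> [e | x y [axy wxy] | x y [bxy wxy]]; first by apply: wL.
  have [fxy|fxy|fxy] := ltngtP (f x) (f y).
  - by case: (wo' x y); rewrite // /galvin_rel axy eqxx fxy.
  - by case: (wo' y x); rewrite // /galvin_rel axy eqxx fxy.
  - by apply: fa; rewrite axy (val_inj fxy).
have [fxy|fxy|fxy] := ltngtP (f x) (f y).
- by case: (wo' y x); rewrite // /galvin_rel bxy eqxx fxy orbT.
- by case: (wo' x y); rewrite // /galvin_rel bxy eqxx fxy orbT.
- by apply: fb; rewrite bxy (val_inj fxy).
Qed.

(** * Splitting the vertices into blocks *)

(** Number the edges of each fibre consecutively from 0 and put [n.+1]
    consecutive ones in a block.  The second conclusion, that the first edge of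
    each block has a number less than the size of the fibre, is a bound on the
    number of blocks free of division. *)
Lemma split_fibres (E : finType) (V : eqType) (s : E -> V) (n : nat) :
  exists g : E -> nat,
    (forall e, (#|[set x | (s x, g x) == (s e, g e)]| <= n.+1)%N) /\
    (forall e, (g e * n.+1 < #|[set x | s x == s e]|)%N).
Proof.
pose F v := [set x | s x == v].
pose i e := index e (enum (F (s e))).
have ltF e : (i e < #|F (s e)|)%N by rewrite cardE index_mem mem_enum inE.
have i_inj x y : s x = s y -> i x = i y -> x = y.
  rewrite /i => sxy; rewrite sxy => /(congr1 (nth x (enum (F (s y))))).
  by rewrite !nth_index // mem_enum inE ?sxy.
exists (fun e => i e %/ n.+1)%N; split=> e; last first.
  exact: leq_ltn_trans (leq_divM _ _) (ltF e).
rewrite -[leqRHS]card_ord.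
rewrite -(@card_in_imset _ _ (fun x => inord (i x %% n.+1) : 'I_n.+1)).
  exact: max_card.
move=> x y; rewrite !inE => /eqP[sx gx] /eqP[sy gy] /(congr1 val).
rewrite /= !inordK ?ltn_mod // => mxy; apply: i_inj; first by rewrite sx sy.
by rewrite (divn_eq (i x) n.+1) (divn_eq (i y) n.+1) gx gy mxy.
Qed.

Lemma card_multiples_lt (E : finType) (g : E -> nat) (S : {set E}) (n k : nat) :
    {in S &, injective g} -> {in S, forall e, (g e * n.+1 < k)%N} ->
  (#|S| * n.+1 <= k + n)%N.
Proof.
move=> g_inj ltk; rewrite -leq_divRL //.
rewrite cardE -(size_map g) -(size_iota 0 ((k + n) %/ n.+1)).
apply: uniq_leq_size.
  rewrite map_inj_in_uniq ?enum_uniq // => x y.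
  by rewrite !mem_enum; apply: g_inj.
move=> _ /mapP[e + ->]; rewrite mem_enum => /ltk ge.
rewrite mem_iota /= add0n leq_divRL // mulSn; lia.
Qed.

(** An arbitrary orientation of the edges. *)
Lemma edge_endpoints (G : sgraph) :
  exists st : edge G -> G * G,
    forall e, adj (st e).1 (st e).2 /\ val e = [set (st e).1; (st e).2].
Proof.
apply: (fin_all_exists (P := fun e p => adj p.1 p.2 /\ val e = [set p.1; p.2])).
by move=> e; case/imsetP: (valP e) => p padj def_e; exists p.
Qed.

Lemma card_incident_le_degree (G : sgraph) (v : G) :
  (#|[set e : edge G | v \in val e]| <= degree v)%N.
Proof.
rewrite -(card_imset _ val_inj).
apply: leq_trans (leq_imset_card (fun u => [set v; u]) [set u | adj v u]).
apply: subset_leq_card; apply/subsetP=> _ /imsetP[e + ->]; rewrite inE.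
case/imsetP: (valP e) => -[x y] /= adjxy ->.
rewrite !inE => /orP[] /eqP ->; apply/imsetP.
  by exists y; rewrite ?inE.
by exists x; rewrite ?inE 1?adj_sym // setUC.
Qed.

(** At a vertex [v], edges of the same colour lie in different blocks. *)
Lemma card_colour_half (E : finType) (V C : eqType) (s : E -> V) (n : nat)
    (g : E -> nat) (w : E -> C) (v : V) (c : C) :
    (forall e, (g e * n.+1 < #|[set x | s x == s e]|)%N) ->
    injective (fun e => ((s e, g e), w e)) ->
  (#|[set e | (s e == v) && (w e == c)]| * n.+1
     <= #|[set e | s e == v]| + n)%N.
Proof.
move=> gs w_inj; apply: (@card_multiples_lt _ g).
  move=> x y; rewrite !inE => /andP[/eqP sx /eqP wx] /andP[/eqP sy /eqP wy] gxy.
  by apply: w_inj; rewrite sx sy wx wy gxy.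
by move=> x; rewrite inE => /andP[/eqP <- _].
Qed.

Lemma balanced_list_colouring (G : sgraph) (C : choiceType) (n : nat)
    (L : edge G -> {fset C}) :
    (forall e, (n < #|` L e|)%N) ->
  exists w : edge G -> C, (forall e, w e \in L e) /\
    forall v c, (#|[set e : edge G | (v \in val e) && (w e == c)]| * n.+1
                   <= degree v + n.*2)%N.
Proof.
move=> lL; have [st stP] := edge_endpoints G.
pose s e := (st e).1; pose t e := (st e).2.
have [g [gl gk]] := split_fibres s n.
have [h [hl hk]] := split_fibres t n.
have [w [wL wg wh]] := galvin gl hl lL.
exists w; split=> // v c.
have in_e (e : edge G) : (v \in val e) = (s e == v) || (t e == v).
  by case: (stP e) => _ ->; rewrite !inE ![v == _]eq_sym.
have s_neq_t e : s e != t e.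
  case: (stP e) => + _; apply: contraTneq => st_e.
  by rewrite -/(s e) st_e adj_irr.
have deg : (#|[set e | s e == v]| + #|[set e | t e == v]| <= degree v)%N.
  apply: leq_trans (card_incident_le_degree v).
  have -> : [set e : edge G | v \in val e]
              = [set e | s e == v] :|: [set e | t e == v].
    by apply/setP=> e; rewrite !inE in_e.
  rewrite cardsU.
  have -> : [set e | s e == v] :&: [set e | t e == v] = set0.
    apply/setP=> e; rewrite !inE; apply/negP=> /andP[/eqP <- /eqP ts].
    by have := s_neq_t e; rewrite ts eqxx.
  by rewrite cards0 subn0.
have := card_colour_half v c gk wg; have := card_colour_half v c hk wh.
have : (#|[set e : edge G | (v \in val e) && (w e == c)]|
          <= #|[set e | (s e == v) && (w e == c)]|
           + #|[set e | (t e == v) && (w e == c)]|)%N.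
  apply: leq_trans (leq_card_setU _ _); apply: subset_leq_card.
  by apply/subsetP=> e; rewrite !inE in_e andb_orl.
by nia.
Qed.

Theorem theorem10 (R : realType) (l : nat) (alpha : R) (G : sgraph)
    (l_ge2 : (2 <= l)%N)
    (alpha_gt0 : 0 < alpha) (alpha_lt1 : alpha < 1)
    (alpha_l : 1 < alpha * l%:R)
    (min_deg : (2 * l%:R - 2) / (alpha * l%:R - 1) <= (min_degree G)%:R :> R) :
  forall (C : choiceType) (L : edge G -> {fset C}),
    (forall e : edge G, #|` L e|%fset = l) ->
    exists w : edge G -> C,
      (forall e : edge G, w e \in L e) /\ majority_edge_colouring alpha w.
Proof.
case: l l_ge2 alpha_l min_deg => // n _ alpha_l min_deg C L Ll.
have [|w [wL wn]] := @balanced_list_colouring G C n L.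
  by move=> e; rewrite Ll.
exists w; split=> // v c.
(* Multiplied by [l], the goal reads [N * l <= alpha * l * d]; the left side is
   at most [d + 2 * n], and [min_deg] gives [2 * n <= d * (alpha * l - 1)]. *)
have := wn v c; set N := #|_|; set d := degree v.
rewrite -(ler_nat R) natrM natrD -muln2 natrM => leN.
have : (min_degree G)%:R <= d%:R :> R by rewrite ler_nat min_degree_le.
move/(le_trans min_deg); rewrite ler_pdivrMr ?subr_gt0 // => led.
rewrite -(@ler_pM2r _ n.+1%:R) ?ltr0n //; apply: (le_trans leN).
move: led; rewrite -natr1; nra.
Qed.
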